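(* Let $k$ be a positive integer and let $\gamma, \delta$ be real numbers with $\frac{1}{k+1} \le \gamma < \delta \le \frac{1}{k}$. For each positive integer $n$ let $X^{(n)}$ be the random variable on the symmetric group $S_n$ with uniform measure such that $X^{(n)}(\pi)$ is the number of cycles of the permutation $\pi$ with length in $[\gamma n, \delta n]$. Then, as $n \to \infty$, $X^{(n)}$ converges in distribution to the quasi-Poisson$\left(k, \log \frac{\delta}{\gamma}\right)$ distribution.
   Context: For a nonnegative integer $r$ and real $\lambda$, a random variable $X$ is said to have the quasi-Poisson$(r,\lambda)$ distribution if $X$ is supported on $\{0,1,\dots,r\}$ and $\mathbb{E}((X)_j) = \lambda^j$ for $j = 0,1,\dots,r$, where $(z)_j = z(z-1)\cdots(z-j+1)$ is the falling factorial (with $(z)_0=1$, $\lambda^0=1$). These moment conditions determine the distribution uniquely when it exists. $\log$ is the natural logarithm. *)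

(* Defs.v *)
From HB Require Import structures.
From mathcomp Require Import all_boot all_order all_algebra all_fingroup.
From mathcomp Require Import all_classical all_reals all_analysis.

Set Implicit Arguments.
Unset Strict Implicit.
Unset Printing Implicit Defensive.

Import Order.TTheory GRing.Theory Num.Theory.
Import numFieldNormedType.Exports.

Local Open Scope classical_set_scope.
Local Open Scope ring_scope.

(* perm_type T is the head constant that {perm T} unfolds to. *)
HB.instance Definition _ (T : finType) :=
  isPointed.Build (perm_type T) (perm_one T).

HB.instance Definition _ (T : finType) :=
  @isMeasurable.Build default_measure_display (perm_type T) discrete_measurable
    discrete_measurable0 discrete_measurableC discrete_measurableU.

Section uniform_perm.
Context {R : realType} (n : nat).

Definition uniform_perm : set 'S_n -> \bar R :=
  mscale (n`!%:R^-1)%:nng counting.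

HB.instance Definition _ := Measure.on uniform_perm.

Let uniform_permT : uniform_perm [set: 'S_n] = 1%E.
Proof.
have fS : finite_set [set: 'S_n] by exact: finite_finset.
rewrite /uniform_perm /mscale/= /counting asboolT//.
have -> : size (finmap.enum_fset (fset_set [set: 'S_n])) = n`!.
  rewrite -card_Sn cardE; apply/perm_size/uniq_perm => //; rewrite ?enum_uniq//.
  by move=> s; rewrite mem_enum (in_fset_set fS) in_setT.
by rewrite -EFinM mulVf// pnatr_eq0 -lt0n fact_gt0.
Qed.

HB.instance Definition _ :=
  Measure_isProbability.Build _ _ _ uniform_perm uniform_permT.

End uniform_perm.
Arguments uniform_perm R n : clear implicits.

Section cycle_count.
Context {R : realType} (gamma delta : R) (n : nat).

(* [porbits s] lists the cycles of [s] as sets, fixed points included, so the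
   length of a cycle is the cardinal of its orbit. *)
Definition cycle_count (s : 'S_n) : R :=
  #|[pred C in porbits s |
      gamma * n%:R <= (#|C|)%:R <= delta * n%:R]|%:R.

Let measurable_cycle_count : measurable_fun [set: 'S_n] cycle_count.
Proof. by []. Qed.

HB.instance Definition _ :=
  isMeasurableFun.Build _ _ _ _ cycle_count measurable_cycle_count.

Definition cycle_countRV : {RV (uniform_perm R n) >-> R} := cycle_count.

End cycle_count.
Arguments cycle_count {R} gamma delta n s.
Arguments cycle_countRV {R} gamma delta n.

Definition falling_factorial {R : realType} (z : R) (j : nat) : R :=
  \prod_(i < j) (z - i%:R).

(* "X is supported on {0, ..., r}" is read as X in {0, ..., r} almost surely;
   `I_r.+1 is {i | i < r.+1}. *)
Definition quasi_poisson {R : realType} {d : measure_display}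
    {T : measurableType d} {P : probability T R} (r : nat) (lambda : R)
    (X : {RV P >-> R}) : Prop :=
  P (X @^-1` [set i%:R | i in `I_r.+1]) = 1%E /\
  (forall j : nat, (j <= r)%N ->
    'E_P[fun t => falling_factorial (X t) j]%E = (lambda ^+ j)%:E).

(* The variables may live on different probability spaces; convergence in
   distribution is convergence of the distribution functions at every
   continuity point of the limit distribution function. *)
Definition cvg_in_distribution {R : realType} {d : nat -> measure_display}
    {T : forall n, measurableType (d n)} {P : forall n, probability (T n) R}
    {d' : measure_display} {T' : measurableType d'} {Q : probability T' R}
    (X : forall n, {RV (P n) >-> R}) (Y : {RV Q >-> R}) : Prop :=
  forall x : R, {for x, continuous (cdf Y)} ->
    cdf (X n) x @[n --> \oo] --> cdf Y x.

(* Main.v *)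
Require Import Defs.
From HB Require Import structures.
From mathcomp Require Import all_boot all_order all_algebra all_fingroup.
From mathcomp Require Import all_classical all_reals all_analysis.
From mathcomp Require Import measurable_realfun ring lra zify.
Import Order.TTheory GRing.Theory Num.Theory.
Import numFieldNormedType.Exports.

Set Implicit Arguments.
Unset Strict Implicit.
Unset Printing Implicit Defensive.

(** The proof is by factorial moments, made effective by the fact that the
number [X] of cycles with length in the window [[gamma n, delta n]] never
exceeds [k + 1], since [k + 2] such cycles would need more than [n] points.
On [{0, ..., k + 1}] every function is a linear combination of the falling
factorials of order at most [k + 1] ([newton_interpolation]), so the whole law
of [X] is a fixed linear image of its first [k + 2] factorial moments.

These moments can be computed exactly.  Marking a cycle [C] of a permutation
of [D] and deleting it leaves an arbitrary permutation of [D :\: C], and a set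
of [l] points carries [(l - 1)!] cyclic permutations.  The [j]-th factorial
moment is therefore the sum of [1 / (l_1 ... l_j)] over all [j]-tuples of
lengths in the window with [l_1 + ... + l_j <= n] ([cycle_moment]).

For [j <= k] the constraint on the sum is vacuous, because each length is at
most [n / k]: the moment is the [j]-th power of the sum of [1 / l] over the
window, a piece of the harmonic series that tends to [ln (delta / gamma)]
([cvg_tuple_weight]).  For [j = k + 1] all lengths are at least [n / (k + 1)],
so the constraint leaves at most the single tuple of lengths equal to
[n / (k + 1)], and the moment tends to [0] ([cvg_tuple_weight_boundary]).

Consequently the probabilities [P (X = m)] converge.  Their limits form a
probability vector with the prescribed moments, which gives the existence of
the quasi-Poisson law; and since a variable [Y] with that law satisfies the
same moment identities on the same finite support, the distribution functions
converge to that of [Y], at every point. *)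

(** * Deleting a cycle of a permutation *)

Lemma perm_onT (T : finType) (s : {perm T}) : perm_on finset.setT s.
Proof. by apply/fintype.subsetP => t _; rewrite inE. Qed.

Section CycleDecomposition.
Import fintype.
Variable T : finType.
Implicit Types (s t c : {perm T}) (C D : {set T}) (A : pred nat).
Local Open Scope group_scope.

Lemma porbit_eq_in C s t x :
  {in C, forall y, s y \in C} -> {in C, s =1 t} -> x \in C ->
  porbit s x = porbit t x.
Proof.
move=> sC st xC.
have it i : (s ^+ i) x \in C /\ (s ^+ i) x = (t ^+ i) x.
  elim: i => [|i [IH1 IH2]]; first by rewrite !expg0 !perm1.
  by rewrite !expgSr !permM -IH2 -(st _ IH1) sC.
apply/setP => y; apply/porbitP/porbitP => -[i ->]; exists i.
  by case: (it i).
by case: (it i).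
Qed.

Lemma porbit_sub C s x :
  {in C, forall y, s y \in C} -> x \in C -> porbit s x \subset C.
Proof.
move=> sC xC; apply/subsetP => y /porbitP[i ->].
by elim: i => [|i IH]; rewrite ?expg0 ?perm1// expgSr permM sC.
Qed.

Lemma porbits_eq s C x : C \in porbits s -> x \in C -> C = porbit s x.
Proof.
by move=> /imsetP[y _ ->]; rewrite -eq_porbit_mem => /eqP ->.
Qed.

Lemma porbits_stable s C x : C \in porbits s -> (s x \in C) = (x \in C).
Proof.
move=> /imsetP[y _ ->].
have e : porbit s (s x) = porbit s x by rewrite -{2}[s]expg1 porbit_perm.
by rewrite -!eq_porbit_mem e.
Qed.

Lemma porbits_neq0 s C : C \in porbits s -> C != finset.set0.
Proof. by move=> /imsetP[y _ ->]; apply/set0Pn; exists y; exact: porbit_id. Qed.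

Section Product.
Variables (C D : {set T}) (c t : {perm T}).
Hypotheses (cC : perm_on C c) (tD : perm_on (D :\: C) t).

Lemma mul_perm_in x : x \in C -> (c * t) x = c x.
Proof.
by move=> xC; rewrite permM (out_perm tD)// inE (perm_closed _ cC) xC.
Qed.

Lemma mul_perm_out x : x \notin C -> (c * t) x = t x.
Proof. by move=> xC; rewrite permM (out_perm cC). Qed.

Lemma perm_out_closed x : x \notin C -> t x \notin C.
Proof.
move=> xC; case: (boolP (x \in D :\: C)) => xD; last by rewrite (out_perm tD).
by move: xD; rewrite -(perm_closed _ tD) inE => /andP[].
Qed.

Lemma porbit_mul_in x : x \in C -> porbit (c * t) x = porbit c x.
Proof.
apply: porbit_eq_in => y yC; rewrite mul_perm_in//.
by rewrite (perm_closed _ cC).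
Qed.

Lemma porbit_mul_out x : x \notin C -> porbit (c * t) x = porbit t x.
Proof.
move=> xC; apply: (@porbit_eq_in (~: C)); rewrite ?inE// => y; rewrite !inE => yC.
  by rewrite mul_perm_out ?perm_out_closed.
by rewrite mul_perm_out.
Qed.

Lemma mem_porbits_mul : (C \in porbits (c * t)) = (C \in porbits c).
Proof.
have mem s : C \in porbits s -> exists2 x, x \in C & C = porbit s x.
  by move=> /imsetP[x _ ->]; exists x => //; exact: porbit_id.
apply/idP/idP => /mem[x xC eC]; apply/imsetP; exists x => //.
  by rewrite -porbit_mul_in.
by rewrite porbit_mul_in.
Qed.

End Product.

(** The condition [C \subset D] matters for [s] supported in [D]: it discards
the fixed points of [s] outside [D], so that permutations of a subset need not
be transported to a smaller type. *)
Definition cycles_within A D s :=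
  [set C in porbits s | (C \subset D) && A #|C|].

Lemma cycles_within_mul A C D c t :
  perm_on C c -> perm_on (D :\: C) t -> C \in porbits c ->
  C \subset D -> A #|C| ->
  #|cycles_within A D (c * t)| = #|cycles_within A (D :\: C) t|.+1.
Proof.
move=> cC tD Cc CD AC.
have CnI : C \notin cycles_within A (D :\: C) t.
  rewrite !inE !negb_and; apply/orP; right; apply/orP; left.
  apply: contra (porbits_neq0 Cc) => /subsetDP[_].
  by rewrite -finset.setI_eq0 finset.setIid.
transitivity #|C |: cycles_within A (D :\: C) t|; last by rewrite cardsU1 CnI.
apply: eq_card => B; rewrite !inE.
have [->|BC] /= := eqVneq B C; first by rewrite (mem_porbits_mul cC tD) Cc CD AC.
apply/and3P/and3P => -[/imsetP[x _ Bx] BD AB]; split=> //.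
- have xC : x \notin C.
    apply: contra BC => xC; apply/eqP.
    by rewrite Bx (porbit_mul_in cC tD)// -(porbits_eq Cc xC).
  by apply/imsetP; exists x => //; rewrite -(porbit_mul_out cC tD).
- apply/subsetP => y yB; rewrite inE (subsetP BD)// andbT.
  apply: contra BC => yC; apply/eqP.
  have : porbit (c * t) y = B by apply/eqP; rewrite Bx eq_porbit_mem -Bx.
  by move=> <-; rewrite (porbit_mul_in cC tD)// -(porbits_eq Cc yC).
- have xC : x \notin C.
    have := subsetP BD x; rewrite Bx porbit_id => /(_ isT).
    by rewrite inE => /andP[].
  by apply/imsetP; exists x => //; rewrite (porbit_mul_out cC tD).
- by apply: subset_trans BD _; exact: subsetDl.
Qed.

(** Restricting a permutation to one of its cycles and to the complement is
inverse to multiplying permutations with disjoint supports. *)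
Lemma sum_perm_on_cycle C D (G : {perm T} -> nat) : C \subset D ->
  \sum_(s | perm_on D s && (C \in porbits s)) G s =
  \sum_(c | perm_on C c && (C \in porbits c))
    \sum_(t | perm_on (D :\: C) t) G (c * t)%g.
Proof.
move=> CD; rewrite pair_big /=.
rewrite (reindex_onto (fun p : {perm T} * {perm T} => (p.1 * p.2)%g)
  (fun s => (restr_perm C s, restr_perm (~: C) s))) /=; last first.
  move=> s /andP[sD Cs].
  have nC : s \in 'N(C | 'P) by apply/astabsP => x; exact: porbits_stable.
  have nC' : s \in 'N(~: C | 'P) by rewrite astabsC.
  apply/permP => x; rewrite permM.
  have [xC|xC] := boolP (x \in C).
    rewrite (restr_permE nC)// (out_perm (restr_perm_on _ _))//.
    by rewrite inE negbK (porbits_stable _ Cs).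
  rewrite (out_perm (restr_perm_on C s) xC) (restr_permE nC')//.
  by rewrite inE.
apply: eq_bigl => -[c t] /=; apply/andP/andP.
  move=> [/andP[ctD Cct] /eqP[ec et]].
  have cC : perm_on C c by rewrite -ec restr_perm_on.
  have tC : perm_on (~: C) t by rewrite -et restr_perm_on.
  have tDC : perm_on (D :\: C) t.
    apply/subsetP => x tx; rewrite inE.
    have xC : x \notin C.
      by apply: contra tx => xC; rewrite (out_perm tC)// inE negbK.
    rewrite xC /=; apply: contraR tx => xD.
    by have := out_perm ctD xD; rewrite permM (out_perm cC)// => ->.
  by split=> //; rewrite cC -(mem_porbits_mul cC tDC).
move=> [/andP[cC Cc] tD].
have Cct : C \in porbits (c * t) by rewrite (mem_porbits_mul cC tD).
have nC : c * t \in 'N(C | 'P).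
  by apply/astabsP => x; exact: porbits_stable.
have nC' : c * t \in 'N(~: C | 'P) by rewrite astabsC.
split.
  rewrite Cct andbT; apply/subsetP => x; apply: contraR => xD.
  have xC : x \notin C by apply: contra xD; exact: subsetP.
  by rewrite permM (out_perm cC xC) (out_perm tD)// inE (negbTE xD) andbF.
apply/eqP; congr pair; apply/permP => x.
  have [xC|xC] := boolP (x \in C).
    by rewrite (restr_permE nC)// (mul_perm_in cC tD).
  by rewrite (out_perm (restr_perm_on _ _) xC) (out_perm cC).
have [xC|xC] := boolP (x \in C).
  rewrite (out_perm (restr_perm_on _ _)) ?inE ?xC//.
  by rewrite (out_perm tD)// inE xC.
by rewrite (restr_permE nC') ?inE// (mul_perm_out t cC).
Qed.

Definition full_cycles C := [set c : {perm T} | perm_on C c & C \in porbits c].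

Lemma card_perm_on_cycle C D : C \subset D ->
  #|[set s | perm_on D s & C \in porbits s]| =
  (#|full_cycles C| * (#|D| - #|C|)`!)%N.
Proof.
move=> CD; rewrite -sum1dep_card (sum_perm_on_cycle _ CD).
rewrite big_mkcond -sum_nat_const [RHS]big_mkcond /=.
apply: eq_bigr => c _; rewrite inE; case: ifP => // _.
by rewrite sum1_card card_perm cardsDS.
Qed.

End CycleDecomposition.

(** * Factorial moments of cycle counts *)

Section CycleMoments.
Import fintype.
Variable T : finType.
Implicit Types (s t c : {perm T}) (C D : {set T}) (A : pred nat).

Lemma sum_card_porbits_within s D : perm_on D s ->
  (\sum_(C in porbits s | C \subset D) #|C| = #|D|)%N.
Proof.
move=> sD; have sDD y : y \in D -> s y \in D by rewrite perm_closed.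
rewrite -[RHS]sum1_card.
rewrite (partition_big (porbit s)
  (fun C => (C \in porbits s) && (C \subset D))) /=; last first.
  by move=> x xD; rewrite imset_f// porbit_sub.
apply: eq_bigr => C /andP[Cs CD]; rewrite -sum1_card; apply: eq_bigl => x.
apply/idP/andP => [xC|[_ /eqP <-]]; last exact: porbit_id.
by rewrite (subsetP CD)// -(porbits_eq Cs xC).
Qed.

Lemma cycles_within_bound A m s D : perm_on D s ->
  (forall l, A l -> (m <= l)%N) -> (m * #|cycles_within A D s| <= #|D|)%N.
Proof.
move=> sD mA; rewrite -(sum_card_porbits_within sD) mulnC -sum_nat_const.
rewrite big_mkcond [leqRHS]big_mkcond /=; apply: leq_sum => C _.
by rewrite inE; case: ifP => // /and3P[-> -> /mA].
Qed.

Lemma sum_subsets_card (V : nmodType) D (g : nat -> V) :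
  (\sum_(C : {set T} | C \subset D) g #|C| =
   \sum_(0 <= l < #|D|.+1) g l *+ 'C(#|D|, l))%R.
Proof.
rewrite big_mkord.
rewrite (partition_big (fun C : {set T} => inord #|C| : 'I_#|D|.+1) predT)//=.
apply: eq_bigr => l _; rewrite -cards_draws -GRing.sumr_const.
have le (C : {set T}) : C \subset D -> (inord #|C| == l) = (#|C| == l).
  by move=> CD; rewrite -val_eqE /= inordK// ltnS subset_leq_card.
apply: eq_big => [C|C /andP[CD]].
  by rewrite inE; case: (boolP (C \subset D)) => //= /le.
by rewrite le// => /eqP ->.
Qed.

(** Count the pairs of a permutation of [D] and a point of [D] in two ways,
grouping them by the cycle [C] through the point.  With [n = #|D|] there are
[n * n!] pairs.  By induction, the [C] of a given size [l] with [0 < l < n]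
account together for ['C(n, l) * l! * (n - l)! = n!] of them, whatever [l] is;
this leaves [n!] pairs with [C = D]. *)
Lemma card_full_cycles C : C != finset.set0 -> #|full_cycles C| = (#|C|.-1)`!.
Proof.
have [m] := ubnP #|C|; elim: m C => // m IH D; rewrite ltnS => Dm D0.
have D_gt0 : (0 < #|D|)%N by rewrite card_gt0.
have key : (\sum_(C : {set T} | C \subset D) #|C| * (#|full_cycles C| * (#|D| - #|C|)`!) =
    (#|D|)`! * #|D|)%N.
  under eq_bigr => C CD do rewrite -card_perm_on_cycle// mulnC -sum_nat_const.
  rewrite -card_perm -sum_nat_const.
  rewrite (exchange_big_dep (mem (perm_on D))) /=; last first.
    by move=> C s _; rewrite inE => /andP[].
  apply: eq_bigr => s sD; rewrite -(sum_card_porbits_within sD).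
  by apply: eq_bigl => C; rewrite inE [perm_on D s]sD andbC.
(* The induction hypothesis turns all the summands but one into an explicit
   function of the size of C. *)
have rest : (\sum_(C : {set T} | C \subset D)
    (if #|C| == #|D| then #|D| * #|full_cycles D|
     else if #|C| == 0 then 0 else (#|D|)`! %/ 'C(#|D|, #|C|)) =
    (#|D|)`! * #|D|)%N.
  rewrite -key; apply: eq_bigr => C CD.
  have [eCD|nCD] := eqVneq #|C| #|D|.
    have -> : C = D by apply/eqP; rewrite eqEcard CD eCD leqnn.
    by rewrite subnn muln1.
  have [->|C0] := eqVneq #|C| 0; first by rewrite mul0n.
  have CDlt : (#|C| < #|D|)%N by rewrite ltn_neqAle nCD subset_leq_card.
  have C_gt0 : (0 < #|C|)%N by rewrite lt0n.
  rewrite IH -?card_gt0//; last exact: leq_trans CDlt Dm.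
  rewrite mulnA -[in (#|C| * _)%N](prednK C_gt0) -factS prednK//.
  by rewrite -(bin_fact (ltnW CDlt)) mulKn// bin_gt0 ltnW.
move: rest.
rewrite (sum_subsets_card D (fun l => if l == #|D| then #|D| * #|full_cycles D|
     else if l == 0 then 0 else (#|D|)`! %/ 'C(#|D|, l)))%N.
have natM a b : (a *+ b)%R = (b * a)%N.
  by elim: b => // b IHb; rewrite GRing.mulrS IHb mulSn.
under eq_bigr => l _ do rewrite natM.
rewrite big_nat_recr//= eqxx binn mul1n big_ltn//=.
rewrite [X in (X + _ + _)%N = _](_ : _ = 0)%N; last first.
  by rewrite eq_sym gtn_eqF// muln0.
rewrite add0n (eq_big_nat _ _ (F2 := fun=> (#|D|)`!)); last first.
  move=> l /andP[l0 lD]; rewrite (ltn_eqF lD) gtn_eqF//.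
  rewrite muln_divA ?mulKn ?bin_gt0 ?(ltnW lD)//.
  by rewrite -(bin_fact (ltnW lD)) dvdn_mulr.
rewrite sum_nat_const_nat.
case: #|D| D_gt0 => // n _; rewrite subn1 /= mulnS [(n * _)%N]mulnC addnC.
by move=> /addIn/eqP; rewrite factS eqn_pmul2l// => /eqP.
Qed.

(** Since [n ^_ j.+1 = n * n.-1 ^_ j], a factorial moment marks one cycle and
takes the lower moment of the others; deleting the marked cycle lowers the
count by exactly one. *)
Lemma sum_cycles_within_ffactS A j D :
  (\sum_(s | perm_on D s) #|cycles_within A D s| ^_ j.+1 =
   \sum_(C : {set T} | (C \subset D) && A #|C|) #|full_cycles C| *
     \sum_(t | perm_on (D :\: C) t) #|cycles_within A (D :\: C) t| ^_ j)%N.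
Proof.
under eq_bigr => s _ do rewrite ffactnS -sum_nat_const.
rewrite (exchange_big_dep (fun C : {set T} => (C \subset D) && A #|C|)) /=; last first.
  by move=> s C _; rewrite inE => /and3P[_ -> ->].
apply: eq_bigr => C /andP[CD AC].
under eq_bigl => s do rewrite inE CD AC !andbT.
rewrite sum_perm_on_cycle// -sum_nat_const [RHS]big_mkcond [LHS]big_mkcond /=.
apply: eq_bigr => c _; rewrite inE; case: ifP => // /andP[cC Cc].
by apply: eq_bigr => t tD; rewrite (@cycles_within_mul _ A C).
Qed.

End CycleMoments.

Section TupleWeight.
Variable R : numFieldType.
Local Open Scope ring_scope.
Import GRing.Theory Num.Theory.

(** The sum of [1 / (l_1 ... l_j)] over the [j]-tuples of positive integers
satisfying [A] with [l_1 + ... + l_j <= n], organised by [l_1]. *)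
Fixpoint tuple_weight (A : pred nat) (j n : nat) : R :=
  if j is i.+1 then
    \sum_(1 <= l < n.+1 | A l) tuple_weight A i (n - l) / l%:R
  else 1.

(** In the recursion, the [l]-subsets of [D] carry in all
['C(n, l) * (l - 1)! * (n - l)! = n! / l] pairs of a cyclic permutation and a
permutation of the rest. *)
Lemma cycle_moment (T : finType) (A : pred nat) j (D : {set T}) :
  (\sum_(s : {perm T} | perm_on D s) #|cycles_within A D s| ^_ j)%N%:R =
  (#|D|)`!%:R * tuple_weight A j #|D|.
Proof.
elim: j D => [|j IH] D.
  by rewrite mulr1 -card_perm -sum1_card; congr (_%:R); apply: eq_bigr.
rewrite sum_cycles_within_ffactS big_mkcondr natr_sum /=.
pose g l : R := if A l && (l != 0)%N then (l.-1)`!%:R *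
  ((#|D| - l)`!%:R * tuple_weight A j (#|D| - l)) else 0.
rewrite (eq_bigr (fun C : {set T} => g #|C|)); last first.
  move=> C CD; rewrite /g cards_eq0; case: ifP => //= AC.
  have [->|C0] /= := eqVneq C finset.set0.
    suff -> : full_cycles finset.set0 = finset.set0 :> {set {perm T}}.
      by rewrite cards0 mul0n.
    apply/setP => c; rewrite !inE; apply/negbTE; rewrite negb_and orbC.
    by apply/orP; left; apply/negP => /porbits_neq0; rewrite eqxx.
  by rewrite natrM card_full_cycles// IH cardsDS.
rewrite (sum_subsets_card D g) big_ltn// /g/= andbF mul0rn add0r.
rewrite [in RHS]big_mkcond mulr_sumr; apply: eq_big_nat => l /andP[l0 lD].
rewrite gtn_eqF// andbT; case: ifP => _; last by rewrite mul0rn mulr0.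
have ln : l%:R != 0 :> R by rewrite pnatr_eq0 gtn_eqF.
rewrite -(@bin_fact #|D| l)// -[in X in _ = X * _](prednK l0) factS prednK//.
by rewrite !natrM -mulr_natl; field.
Qed.

End TupleWeight.

(** * Weights of tuples with large entries *)

Local Open Scope classical_set_scope.
Local Open Scope ring_scope.

Section TupleWeightBounds.
Variable R : realType.
Implicit Types (A : pred nat) (a b j n : nat).
Local Notation tw := (@tuple_weight R).

Lemma tuple_weight_ge0 A j n : 0 <= tw A j n.
Proof.
elim: j n => [|j IH] n //=; apply: sumr_ge0 => l _.
by rewrite divr_ge0.
Qed.

Lemma le_tuple_weight A j m n : (m <= n)%N -> tw A j m <= tw A j n.
Proof.
elim: j m n => [|j IH] m n mn //=.
rewrite [leRHS](@big_cat_nat _ _ _ m.+1)//= -[leLHS]addr0.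
apply: lerD; last first.
  by apply: sumr_ge0 => l _; rewrite divr_ge0 ?tuple_weight_ge0.
by apply: ler_sum => l _; rewrite ler_wpM2r ?invr_ge0// IH// leq_sub2r.
Qed.

(** When [j] entries always fit in [n], the constraint on their sum is vacuous
and the sum over tuples factors. *)
Lemma tuple_weight_expn A b j n : (forall l, A l -> (l <= b)%N) ->
  (j * b <= n)%N -> tw A j n = tw A 1 b ^+ j.
Proof.
move=> Ab; elim: j n => [|j IH] n jbn //=.
have bn : (b <= n)%N by lia.
rewrite (@big_cat_nat _ _ _ b.+1)//= [X in _ + X]big_nat_cond [X in _ + X]big1 ?addr0; last first.
  by move=> l /andP[/andP[lb _] /Ab lb']; lia.
rewrite exprS mulr_suml [LHS]big_nat_cond [RHS]big_nat_cond.
apply: eq_bigr => l /andP[/andP[l0 lb] /Ab Al].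
by rewrite IH ?mul1r 1?mulrC//; lia.
Qed.

Lemma tuple_weight_eq0 A a j n : (forall l, A l -> (a <= l)%N) ->
  (n < j * a)%N -> tw A j n = 0.
Proof.
move=> aA; elim: j n => [|j IH] n //= jan.
rewrite big_nat_cond big1// => l /andP[/andP[l0 ln] /aA al].
by rewrite IH ?mul0r//; lia.
Qed.

(** If [k + 1] entries of the least possible size [a] already fill [n], then the
first entry must be [a] itself, or else the remaining [k] would not fit. *)
Lemma tuple_weight_boundary A a b k n :
  (forall l, A l -> (a <= l <= b)%N) -> (0 < a)%N -> (n <= k.+1 * a)%N ->
  tw A k.+1 n <= tw A 1 b ^+ k / a%:R.
Proof.
move=> Aab a0 na.
have aA l : A l -> (a <= l)%N by move/Aab/andP => [].
have Ab l : A l -> (l <= b)%N by move/Aab/andP => [].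
have h0 : 0 <= tw A 1 b ^+ k / a%:R by rewrite divr_ge0// exprn_ge0// tuple_weight_ge0.
have bound m : tw A k m <= tw A 1 b ^+ k.
  rewrite -(@tuple_weight_expn A b k (maxn m (k * b)))//; last exact: leq_maxr.
  by apply: le_tuple_weight; exact: leq_maxl.
apply: (@le_trans _ _ (\sum_(1 <= l < n.+1 | l == a) (tw A 1 b ^+ k / a%:R))).
  rewrite [tw _ _ _]/= big_mkcond [leRHS]big_mkcond !big_nat /=.
  apply: ler_sum => l /andP[l0 ln].
  case: ifPn => [Al|_]; last by case: ifP.
  case: eqVneq => [->|la]; first by rewrite ler_wpM2r// invr_ge0.
  by rewrite (tuple_weight_eq0 aA) ?mul0r//; have := aA _ Al; lia.
rewrite -big_filter; have [|an] := boolP (a \in index_iota 1 n.+1).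
  by move=> an; rewrite filter_pred1_uniq ?iota_uniq// big_seq1.
rewrite big_seq big1// => l; rewrite mem_filter => /andP[/eqP ->].
by rewrite (negbTE an).
Qed.

Lemma ln_succ_bounds (l : nat) : (0 < l)%N ->
  l.+1%:R^-1 <= ln (l.+1%:R : R) - ln l%:R <= l%:R^-1.
Proof.
move=> l0; have l0' : 0 < l%:R :> R by rewrite ltr0n.
have l1 : 0 < l.+1%:R :> R by rewrite ltr0n.
apply/andP; split.
  have := @le_ln1Dx R (- l.+1%:R^-1).
  have -> : 1 - l.+1%:R^-1 = l%:R / l.+1%:R :> R by rewrite -natr1; field; rewrite natr1 gt_eqF.
  rewrite ln_div ?posrE// => /(_ _); rewrite ltrN2 invf_lt1// ltr1n ltnS l0 => /(_ isT).
  by rewrite lerNr opprB.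
have := @le_ln1Dx R (l%:R^-1).
have -> : 1 + l%:R^-1 = l.+1%:R / l%:R :> R by rewrite -natr1; field; rewrite gt_eqF.
by rewrite ln_div ?posrE//; apply; rewrite (@lt_trans _ _ 0)// invr_gt0.
Qed.

(** Both bounds telescope: the logarithm on the left, and on the right also the
gap [1 / l - 1 / (l + 1)] between the two sides of [ln_succ_bounds]. *)
Lemma harmonic_interval_bounds a b : (0 < a)%N -> (a <= b.+1)%N ->
  ln b.+1%:R - ln a%:R <= \sum_(a <= l < b.+1) (l%:R^-1 : R)
    <= ln (b.+1%:R : R) - ln a%:R + a%:R^-1.
Proof.
move=> a0 ab; rewrite -(telescope_sumr (fun l => ln (l%:R : R)) ab).
apply/andP; split.
  rewrite !big_nat; apply: ler_sum => l /andP[al _].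
  by have /andP[] := ln_succ_bounds (leq_trans a0 al).
have -> : a%:R^-1 = b.+1%:R^-1 + \sum_(a <= l < b.+1) (- (l.+1%:R^-1) - - (l%:R^-1)) :> R.
  by rewrite (telescope_sumr (fun l => - (l%:R^-1 : R)) ab); ring.
rewrite addrCA -[leLHS]add0r lerD ?invr_ge0// -big_split /= !big_nat.
apply: ler_sum => l /andP[al _].
have /andP[h1 _] := ln_succ_bounds (leq_trans a0 al).
by rewrite opprK addrA lerDr subr_ge0.
Qed.

End TupleWeightBounds.

(** * Asymptotics of the window of lengths *)

Section Asymptotics.
Variable R : realType.
Variables gamma delta : R.
Hypotheses (gamma_gt0 : 0 < gamma) (gd : gamma < delta).

Definition length_lo (n : nat) : nat := `|Num.ceil (gamma * n%:R)|%N.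
Definition length_hi (n : nat) : nat := Num.truncn (delta * n%:R).

Lemma length_lo_itv n : gamma * n%:R <= (length_lo n)%:R < gamma * n%:R + 1.
Proof.
have c0 : 0 <= Num.ceil (gamma * n%:R).
  by rewrite ceil_ge0 (lt_le_trans _ (mulr_ge0 (ltW gamma_gt0) _)).
rewrite /length_lo natr_absz ger0_norm//.
have := ceil_itv (gamma * n%:R); rewrite intrB mulr1z => /andP[h1 h2].
by rewrite h2 -ltrBlDr.
Qed.

Lemma length_hi_itv n : (length_hi n)%:R <= delta * n%:R < (length_hi n).+1%:R.
Proof. by apply: truncn_itv; rewrite mulr_ge0// ltW// (lt_trans gamma_gt0). Qed.

Definition in_window (n : nat) : pred nat :=
  fun l => gamma * n%:R <= l%:R <= delta * n%:R.

Lemma in_windowE n l : in_window n l = (length_lo n <= l <= length_hi n)%N.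
Proof.
congr andb; last first.
  by rewrite /length_hi truncn_ge_nat// mulr_ge0// ltW// (lt_trans gamma_gt0).
apply/idP/idP => h; last first.
  by have /andP[h1 _] := length_lo_itv n; rewrite (le_trans h1)// ler_nat.
have /andP[_ h1] := length_lo_itv n.
by rewrite -ltnS -(ltr_nat R) -natr1; lra.
Qed.

Lemma cvg_invn : (n%:R^-1 : R) @[n --> \oo] --> (0 : R).
Proof.
rewrite -(cvg_shiftS (fun n => n%:R^-1 : R)); exact: cvg_harmonic.
Qed.

Lemma cvg_length_lo : (length_lo n)%:R / n%:R @[n --> \oo] --> gamma.
Proof.
apply: (@squeeze_cvgr _ _ _ _ (fun=> gamma) (fun n => gamma + n%:R^-1)).
- near=> n; have n0 : 0 < n%:R :> R by rewrite ltr0n; near: n; exact: nbhs_infty_gt.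
  have /andP[h1 h2] := length_lo_itv n.
  rewrite ler_pdivlMr// h1 ler_pdivrMr//= mulrDl mulVf ?gt_eqF//; exact: ltW.
- exact: cvg_cst.
- by rewrite -[X in _ --> X]addr0; apply: cvgD; [exact: cvg_cst|exact: cvg_invn].
Unshelve. all: by end_near. Qed.

Lemma cvg_length_hi : (length_hi n).+1%:R / n%:R @[n --> \oo] --> delta.
Proof.
apply: (@squeeze_cvgr _ _ _ _ (fun=> delta) (fun n => delta + n%:R^-1)).
- near=> n; have n0 : 0 < n%:R :> R by rewrite ltr0n; near: n; exact: nbhs_infty_gt.
  have /andP[h1 h2] := length_hi_itv n.
  rewrite ler_pdivlMr// (ltW h2) ler_pdivrMr//= mulrDl mulVf ?gt_eqF//.
  by rewrite -natr1 lerD2r.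
- exact: cvg_cst.
- by rewrite -[X in _ --> X]addr0; apply: cvgD; [exact: cvg_cst|exact: cvg_invn].
Unshelve. all: by end_near. Qed.

Lemma length_lo_gt0 n : (0 < n)%N -> (0 < length_lo n)%N.
Proof.
move=> n0; have /andP[h _] := length_lo_itv n.
by rewrite -(ltr_nat R) (lt_le_trans _ h)// mulr_gt0// ltr0n.
Qed.

Lemma cvg_inv_length_lo : (length_lo n)%:R^-1 @[n --> \oo] --> (0 : R).
Proof.
apply: (@squeeze_cvgr _ _ _ _ (fun=> 0) (fun n => gamma^-1 * n%:R^-1)).
- near=> n; have n0 : 0 < n%:R :> R by rewrite ltr0n; near: n; exact: nbhs_infty_gt.
  have /andP[h1 h2] := length_lo_itv n.
  rewrite invr_ge0 ler0n /= -invfM lef_pV2 ?posrE ?mulr_gt0//.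
  by rewrite (lt_le_trans _ h1)// mulr_gt0.
- exact: cvg_cst.
- by rewrite -[X in _ --> X](mulr0 gamma^-1); apply: cvgMr; exact: cvg_invn.
Unshelve. all: by end_near. Qed.

Lemma tuple_weight1 n : (0 < n)%N ->
  tuple_weight R (in_window n) 1 (length_hi n) =
  \sum_(length_lo n <= l < (length_hi n).+1) l%:R^-1.
Proof.
move=> n0; have a0 := length_lo_gt0 n0.
rewrite [RHS](@big_nat_widenl _ _ _ _ 1)// /= [LHS]big_nat_cond [RHS]big_nat_cond.
by apply: eq_big => [l|l _]; rewrite ?mul1r// in_windowE ltnS; lia.
Qed.

Lemma cvg_tuple_weight1 :
  tuple_weight R (in_window n) 1 (length_hi n) @[n --> \oo] --> ln (delta / gamma).
Proof.
pose L n : R := ln ((length_hi n).+1%:R / n%:R) - ln ((length_lo n)%:R / n%:R).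
have cL : L n @[n --> \oo] --> ln (delta / gamma).
  rewrite ln_div ?posrE//; last exact: lt_trans gd.
  apply: cvgB.
    apply: (cvg_comp _ _ cvg_length_hi); apply: continuous_ln.
    exact: lt_trans gd.
  exact: (cvg_comp _ _ cvg_length_lo (continuous_ln gamma_gt0)).
apply: (@squeeze_cvgr _ _ _ _ L (fun n => L n + (length_lo n)%:R^-1)) => //; last first.
  by rewrite -[X in _ --> X]addr0; apply: cvgD => //; exact: cvg_inv_length_lo.
near=> n; have n0 : (0 < n)%N by near: n; exact: nbhs_infty_gt.
have a0 := length_lo_gt0 n0.
have ab : (length_lo n <= (length_hi n).+1)%N.
  rewrite -(ler_nat R); have /andP[_ h1] := length_lo_itv n.
  have /andP[_ h2] := length_hi_itv n.
  suff : gamma * n%:R + 1 <= delta * n%:R by lra.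
  have : (delta - gamma)^-1 <= n%:R by near: n; exact: nbhs_infty_ger.
  by rewrite -[_^-1]mul1r ler_pdivrMr ?subr_gt0// => h; lra.
rewrite tuple_weight1// /L !ln_div ?posrE ?ltr0n//.
by rewrite opprB addrA subrK; exact: harmonic_interval_bounds.
Unshelve. all: by end_near. Qed.

Lemma cvg_tuple_weight1_expn j :
  tuple_weight R (in_window n) 1 (length_hi n) ^+ j @[n --> \oo] -->
  ln (delta / gamma) ^+ j.
Proof.
apply: (@cvg_comp _ _ _ (fun n => tuple_weight R (in_window n) 1 (length_hi n))
  (fun x => x ^+ j) _ _ _ cvg_tuple_weight1).
exact: exprn_continuous.
Qed.

Variable k : nat.
Hypotheses (k_gt0 : (0 < k)%N).
Hypotheses (lo : k.+1%:R^-1 <= gamma) (hi : delta <= k%:R^-1).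

(** Each length is at most [delta n <= n / k], so [j <= k] of them always fit. *)
Lemma cvg_tuple_weight j : (j <= k)%N ->
  tuple_weight R (in_window n) j n @[n --> \oo] --> ln (delta / gamma) ^+ j.
Proof.
move=> jk.
have e n : tuple_weight R (in_window n) j n =
    tuple_weight R (in_window n) 1 (length_hi n) ^+ j.
  apply: tuple_weight_expn => [l|]; first by rewrite in_windowE => /andP[].
  apply: (@leq_trans (k * length_hi n)); first by rewrite leq_mul2r jk orbT.
  rewrite -(ler_nat R) natrM; have /andP[h _] := length_hi_itv n.
  have kp : 0 < k%:R :> R by rewrite ltr0n.
  rewrite -ler_pdivlMl// (le_trans h)// ler_wpM2r//.
rewrite (_ : (fun n => _) = (fun n => tuple_weight R (in_window n) 1 (length_hi n) ^+ j)); last exact/funext.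
exact: cvg_tuple_weight1_expn.
Qed.

Lemma leq_mul_length_lo n : (n <= k.+1 * length_lo n)%N.
Proof.
rewrite -(ler_nat R) natrM; have /andP[h _] := length_lo_itv n.
rewrite -ler_pdivrMl ?ltr0n// (le_trans _ h)// ler_wpM2r//.
Qed.

Lemma cvg_tuple_weight_boundary :
  tuple_weight R (in_window n) k.+1 n @[n --> \oo] --> (0 : R).
Proof.
apply: (@squeeze_cvgr _ _ _ _ (fun=> 0)
  (fun n => tuple_weight R (in_window n) 1 (length_hi n) ^+ k * (length_lo n)%:R^-1)).
- near=> n; have n0 : (0 < n)%N by near: n; exact: nbhs_infty_gt.
  rewrite tuple_weight_ge0 /=.
  apply: tuple_weight_boundary; [|exact: length_lo_gt0|exact: leq_mul_length_lo].
  by move=> l; rewrite in_windowE.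
- exact: cvg_cst.
- rewrite -[X in _ --> X](mulr0 (ln (delta / gamma) ^+ k)); apply: cvgM.
    exact: cvg_tuple_weight1_expn.
  exact: cvg_inv_length_lo.
Unshelve. all: by end_near. Qed.

End Asymptotics.

(** * Laws with finite support *)

Lemma falling_factorial_natr (R : realType) (m j : nat) :
  Defs.falling_factorial (m%:R : R) j = (m ^_ j)%:R.
Proof.
rewrite /Defs.falling_factorial; elim: j => [|j IH]; first by rewrite big_ord0.
rewrite big_ord_recr /= IH ffactnSr natrM.
have [jm|mj] := leqP j m; first by rewrite natrB.
by rewrite ffact_small// !mul0r.
Qed.

Lemma measurable_falling_factorial (R : realType) (j : nat) :
  measurable_fun [set: R] (fun y : R => Defs.falling_factorial y j).
Proof.
by apply: measurable_prod => i _; exact: measurable_funB.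
Qed.

(** The system for the coefficients is triangular: [m ^_ j] vanishes for [m < j]
and not for [m = j]. *)
Lemma newton_interpolation (R : numFieldType) (f : nat -> R) (N : nat) :
  exists c : nat -> R, forall m, (m < N)%N ->
    f m = \sum_(0 <= j < N) c j * (m ^_ j)%:R.
Proof.
elim: N => [|N [c cP]]; first by exists (fun=> 0).
pose S m := \sum_(0 <= j < N) c j * (m ^_ j)%:R.
exists (fun j => if j == N then (f N - S N) / (N ^_ N)%:R else c j) => m mN.
rewrite big_nat_recr//= eqxx.
rewrite (eq_big_nat _ _ (F2 := fun j => c j * (m ^_ j)%:R)); last first.
  by move=> j /andP[_ jN]; rewrite ltn_eqF.
move: mN; rewrite ltnS leq_eqVlt => /predU1P[->|mN].
  by rewrite divfK ?subrKC// pnatr_eq0 ffactnn -lt0n fact_gt0.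
by rewrite (ffact_small mN) mulr0 addr0 cP.
Qed.

Lemma uniform_permE (R : realType) n (S : set 'S_n) :
  uniform_perm R n S = ((\sum_(s : 'S_n) \1_S s) / n`!%:R : R)%:E.
Proof.
have fS : finite_set S by exact: finite_finset.
rewrite /uniform_perm /mscale/= /counting asboolT// -EFinM mulrC; congr (_ * _)%:E.
have -> : size (finmap.enum_fset (fset_set S)) = #|[pred s : 'S_n | s \in S]|.
  rewrite cardE; apply/perm_size/uniq_perm => //; rewrite ?enum_uniq//.
  by move=> s; rewrite mem_enum (in_fset_set fS).
rewrite -sum1_card natr_sum big_mkcond; apply: eq_bigr => s _.
by rewrite indicE inE; case: (_ \in _).
Qed.

Section FinitelySupported.
Context {R : realType} {d : measure_display} {T : measurableType d}.
Variables (P : probability T R) (X : {RV P >-> R}) (r : nat).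
Hypothesis supp : P (X @^-1` [set i%:R | i in `I_r.+1]) = 1%E.

Lemma preimage_natsE : X @^-1` [set i%:R | i in `I_r.+1] =
  \big[setU/set0]_(m <- iota 0 r.+1) (X @^-1` [set m%:R]).
Proof.
have im i : (i \in iota 0 r.+1) = (i < r.+1)%N by rewrite mem_iota.
rewrite -bigcup_seq; apply/seteqP; split => t.
  by move=> [i ir iX]; exists i => //; move: ir; rewrite /= -im.
by move=> [i ir iX]; exists i => //; move: ir; rewrite /= -im.
Qed.

(** Off a null set [X] takes finitely many values, so [g] need not be integrable
a priori and the expectation is a finite sum over the fibres of [X]. *)
Lemma expectation_finite_support (g : R -> R) : measurable_fun setT g ->
  ('E_P[g \o X] =
    (\sum_(0 <= m < r.+1) g m%:R * fine (P (X @^-1` [set m%:R])))%:E)%E.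
Proof.
move=> mg; pose E := X @^-1` [set (i%:R : R) | i in `I_r.+1].
have mE m : measurable (X @^-1` [set m%:R]).
  by rewrite -[_ @^-1` _]setTI; exact: measurable_funPT.
have mEE : measurable E.
  by rewrite /E preimage_natsE; exact: bigsetU_measurable.
have PE0 : P (~` E) = 0%E by rewrite probability_setC// /E supp subee.
have mgX : measurable_fun setT (g \o X).
  by apply: measurableT_comp => //.
have mgXe := (measurable_EFinP setT (g \o X)).2 mgX.
rewrite unlock.
rewrite (@ae_eq_integral _ _ _ _ _ ((EFin \o (g \o X)) \_ E))//; last 2 first.
- by apply/(measurable_restrictT _ mEE); exact: measurable_funTS.
- exists (~` E); split=> //; first exact: measurableC.
  move=> t /=; apply: contra_not => Et _; rewrite patchE.
  by rewrite mem_set//; apply: contrapT.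
rewrite -integral_mkcond /E preimage_natsE.
rewrite (@integral_bigsetU_EFin _ _ _ _ _ _ (g \o X))//; first last.
- exact: measurable_funTS.
- by move=> i j _ _ [t /= [-> /eqP]]; rewrite eqr_nat => /eqP.
- exact: iota_uniq.
rewrite -sumEFin /index_iota subn0; apply: eq_bigr => m _.
rewrite (eq_integral (cst (g m%:R)%:E)); last first.
  by move=> t; rewrite inE /= => ->.
by rewrite integral_cst// EFinM fineK// fin_num_measure.
Qed.
End FinitelySupported.

Section DiscreteLaw.
Context {R : realType}.
Variables (p : nat -> R) (r : nat).
Hypotheses (p0 : forall m, 0 <= p m) (p1 : \sum_(0 <= m < r.+1) p m = 1).

Definition nat_law : set R -> \bar R :=
  msum (fun m => mscale (NngNum (p0 m)) (\d_(m%:R : R))) r.+1.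

HB.instance Definition _ := Measure.on nat_law.

Lemma nat_lawE (A : set R) : nat_law A = (\sum_(0 <= m < r.+1) p m * \1_A m%:R)%:E.
Proof. by rewrite /nat_law /msum /mscale /= /dirac big_mkord -sumEFin. Qed.

Let nat_lawT : nat_law setT = 1%E.
Proof.
rewrite nat_lawE -p1; congr EFin; apply: eq_bigr => m _.
by rewrite indicT mulr1.
Qed.

HB.instance Definition _ := Measure_isProbability.Build _ _ _ nat_law nat_lawT.

(** The identity, under a name of its own to carry the structure of a random
variable. *)
Definition nat_law_id : R -> R := id.

HB.instance Definition _ := @isMeasurableFun.Build _ _ R R nat_law_id
  (@measurable_id _ R setT).

Definition nat_lawRV : {RV nat_law >-> R} := nat_law_id.

Lemma quasi_poisson_nat_lawRV (lambda : R) :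
  (forall j, (j <= r)%N -> \sum_(0 <= m < r.+1) p m * (m ^_ j)%:R = lambda ^+ j) ->
  quasi_poisson r lambda nat_lawRV.
Proof.
move=> mom.
have supp : nat_law (nat_lawRV @^-1` [set i%:R | i in `I_r.+1]) = 1%E.
  rewrite nat_lawE -p1; congr EFin; apply: eq_big_nat => m /andP[_ mr].
  by rewrite indicE mem_set ?mulr1//; exists m.
split=> // j jr.
apply: etrans
  (expectation_finite_support supp (measurable_falling_factorial j)) _.
rewrite -mom//; congr EFin; apply: eq_big_nat => m /andP[_ mr].
rewrite falling_factorial_natr mulrC; congr (_ * _).
rewrite [X in fine X](nat_lawE) /=.
rewrite (bigD1_seq m) ?mem_index_iota ?iota_uniq//=.
rewrite indicE mem_set// mulr1 big1 ?addr0// => i im.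
rewrite indicE memNset ?mulr0// => /eqP; rewrite eqr_nat; exact/negP.
Qed.

End DiscreteLaw.

(** * The limit law of the cycle count *)

Section LimitLaw.
Context {R : realType}.
Variables gamma delta : R.

Definition window_count n (s : 'S_n) : nat :=
  #|cycles_within (in_window gamma delta n) finset.setT s|.

Definition mean_count n (f : nat -> R) : R :=
  (\sum_(s : 'S_n) f (window_count s)) / n`!%:R.

Lemma cycle_countE n (s : 'S_n) : cycle_count gamma delta n s = (window_count s)%:R.
Proof.
rewrite /cycle_count; congr (_%:R); apply: eq_card => C.
by rewrite inE [in RHS]inE finset.subsetT.
Qed.

Lemma cdf_cycle_countE n x :
  cdf (cycle_countRV gamma delta n) x =
  (mean_count n (fun m => \1_`]-oo, x] m%:R))%:E.
Proof.
apply: etrans (uniform_permE _ _) _; rewrite /mean_count.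
congr (_ / _)%:E; apply: eq_bigr => s _.
by rewrite !indicE -cycle_countE.
Qed.

Lemma mean_count_ffact n j :
  mean_count n (fun m => (m ^_ j)%:R) = tuple_weight R (in_window gamma delta n) j n.
Proof.
rewrite /mean_count -natr_sum.
have := @cycle_moment R 'I_n (in_window gamma delta n) j finset.setT.
rewrite cardsT card_ord.
rewrite [X in X%:R = _](_ : _ = \sum_(s : 'S_n) window_count s ^_ j)%N; last first.
  by apply: eq_bigl => s; rewrite perm_onT.
by move=> ->; rewrite mulrC mulKf// pnatr_eq0 -lt0n fact_gt0.
Qed.

Lemma mean_count_sum n N (c : nat -> R) (f : nat -> nat -> R) :
  mean_count n (fun m => \sum_(0 <= j < N) c j * f j m) =
  \sum_(0 <= j < N) c j * mean_count n (f j).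
Proof.
rewrite /mean_count exchange_big mulr_suml /=; apply: eq_bigr => j _.
by rewrite -mulr_sumr mulrA.
Qed.

Variable k : nat.
Hypotheses (k_gt0 : (0 < k)%N) (gd : gamma < delta).
Hypotheses (lo : k.+1%:R^-1 <= gamma) (hi : delta <= k%:R^-1).

Let gamma_gt0 : 0 < gamma.
Proof. by rewrite (lt_le_trans _ lo)// invr_gt0. Qed.

Lemma window_count_ltn n (s : 'S_n) : (0 < n)%N -> (window_count s < k.+2)%N.
Proof.
move=> n0.
have lo0 := length_lo_gt0 gamma_gt0 n0.
rewrite ltnS -(leq_pmul2l lo0).
apply: leq_trans (_ : n <= _)%N; last by rewrite mulnC; exact: leq_mul_length_lo.
rewrite -[leqRHS](card_ord n) -cardsT; apply: cycles_within_bound.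
  exact: perm_onT.
by move=> l; rewrite in_windowE// => /andP[].
Qed.

Lemma eq_mean_count n (f g : nat -> R) : (0 < n)%N ->
  (forall m, (m < k.+2)%N -> f m = g m) -> mean_count n f = mean_count n g.
Proof.
move=> n0 fg; rewrite /mean_count; congr (_ / _); apply: eq_bigr => s _.
exact/fg/window_count_ltn.
Qed.

(** The last moment, of order [k + 1], comes from the single tuple of lengths
[n / (k + 1)] and vanishes in the limit. *)
Definition limit_moment j : R := if (j <= k)%N then ln (delta / gamma) ^+ j else 0.

Lemma cvg_mean_ffact j : (j < k.+2)%N ->
  mean_count n (fun m => (m ^_ j)%:R) @[n --> \oo] --> limit_moment j.
Proof.
rewrite ltnS leq_eqVlt /limit_moment => jk.
under eq_fun => n do rewrite mean_count_ffact.
case/predU1P: jk => [->|jk].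
  by rewrite ltnn; exact: cvg_tuple_weight_boundary.
rewrite (jk : j <= k)%N; exact: (@cvg_tuple_weight _ _ _ gamma_gt0 gd k).
Qed.

(** The count is at most [k + 1] as soon as [0 < n], so an expansion of [f] into
falling factorials valid up to [k + 1] suffices. *)
Lemma cvg_mean_count (f c : nat -> R) :
  (forall m, (m < k.+2)%N -> f m = \sum_(0 <= j < k.+2) c j * (m ^_ j)%:R) ->
  mean_count n f @[n --> \oo] --> \sum_(0 <= j < k.+2) c j * limit_moment j.
Proof.
move=> fc.
have cv : \sum_(0 <= j < k.+2) c j * mean_count n (fun m => (m ^_ j)%:R)
    @[n --> \oo] --> \sum_(0 <= j < k.+2) c j * limit_moment j.
  rewrite big_mkord; under eq_fun => n do rewrite big_mkord.
  apply: cvg_big => [|j _]; first exact: add_continuous.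
  by apply: cvgMr; exact: cvg_mean_ffact.
apply: cvg_trans cv; apply: near_eq_cvg; near=> n.
rewrite -mean_count_sum; apply: esym; apply: eq_mean_count => //.
by near: n; exact: nbhs_infty_gt.
Unshelve. all: by end_near. Qed.

(** The limits of [P (X = m)] are nonnegative as limits of probabilities, which
is not apparent from the moments.  A priori they are supported on
[{0, ..., k + 1}]; the vanishing of the moment of order [k + 1] removes the
last atom. *)
Lemma limit_pmf_exists : exists p : nat -> R,
  [/\ forall m, 0 <= p m &
      forall j, (j <= k)%N ->
        \sum_(0 <= m < k.+1) p m * (m ^_ j)%:R = ln (delta / gamma) ^+ j].
Proof.
pose at_ m := fun i : nat => (i == m)%:R : R.
have cv m : cvg (mean_count n (at_ m) @[n --> \oo]).
  have [c cE] := newton_interpolation (at_ m) k.+2.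
  apply/cvg_ex; eexists; exact: cvg_mean_count cE.
pose p m := lim (mean_count n (at_ m) @[n --> \oo]).
have p0 m : 0 <= p m.
  apply: limr_ge; first exact: cv.
  by apply: nearW => n; rewrite /mean_count divr_ge0// sumr_ge0.
have momp j : (j < k.+2)%N ->
    \sum_(0 <= m < k.+2) (m ^_ j)%:R * p m = limit_moment j.
  move=> jk.
  suff cvm : mean_count n (fun m => (m ^_ j)%:R) @[n --> \oo] -->
      \sum_(0 <= m < k.+2) (m ^_ j)%:R * p m.
    exact: cvg_unique cvm (cvg_mean_ffact jk).
  have cvs : \sum_(0 <= m < k.+2) (m ^_ j)%:R * mean_count n (at_ m)
      @[n --> \oo] --> \sum_(0 <= m < k.+2) (m ^_ j)%:R * p m.
    rewrite big_mkord; under eq_fun => n do rewrite big_mkord.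
    apply: cvg_big => [|m _]; first exact: add_continuous.
    by apply: cvgMr; exact: cv.
  apply: cvg_trans cvs; apply: near_eq_cvg; near=> n.
  rewrite -mean_count_sum; apply: eq_mean_count.
    by near: n; exact: nbhs_infty_gt.
  move=> m mk; rewrite (bigD1_seq m) ?mem_index_iota ?iota_uniq//=.
  rewrite /at_ eqxx mulr1 big1 ?addr0// => i im.
  by rewrite eq_sym (negbTE im) mulr0.
have pk1 : p k.+1 = 0.
  have := momp k.+1 (ltnSn _).
  rewrite /limit_moment ltnn big_nat_recr//= big_nat big1 ?add0r; last first.
    by move=> m /andP[_ mk]; rewrite ffact_small// mul0r.
  by move=> /eqP; rewrite mulf_eq0 pnatr_eq0 ffactnn gtn_eqF ?fact_gt0//= => /eqP.
exists p; split => // j jk.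
have := momp j (leq_trans jk (leqnSn _)).
rewrite big_nat_recr//= pk1 mulr0 addr0 /limit_moment jk => <-.
by apply: eq_bigr => m _; rewrite mulrC.
Unshelve. all: by end_near. Qed.

(** Both distribution functions at [x] are means of the same indicator [f].  On
the values up to [k + 1] it is a combination of falling factorials, whose means
for the cycle count converge to those for [Y]; the last of these is [0] for [Y]
because [m ^_ k.+1] vanishes on the support. *)
Lemma cvg_cdf_quasi_poisson (d : measure_display) (T : measurableType d)
    (Q : probability T R) (Y : {RV Q >-> R}) :
  quasi_poisson k (ln (delta / gamma)) Y ->
  cvg_in_distribution (cycle_countRV gamma delta) Y.
Proof.
move=> [supp mom] x _.
pose f m : R := \1_`]-oo, x] m%:R.
pose q m := fine (Q (Y @^-1` [set m%:R])).
have momq j : (j <= k)%N ->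
    \sum_(0 <= m < k.+1) (m ^_ j)%:R * q m = ln (delta / gamma) ^+ j.
  move=> jk; apply: EFin_inj; rewrite -mom//.
  apply: esym; apply: etrans
    (expectation_finite_support supp (measurable_falling_factorial j)) _.
  congr EFin; apply: eq_bigr => m _.
  by rewrite falling_factorial_natr.
have [c cE] := newton_interpolation f k.+2.
have -> : cdf Y x = (\sum_(0 <= j < k.+2) c j * limit_moment j)%:E.
  have -> : cdf Y x = 'E_Q[\1_`]-oo, x] \o Y]%E.
    rewrite /cdf /distribution /pushforward -expectation_indic//.
    by rewrite -[_ @^-1` _]setTI; exact: measurable_funPT.
  rewrite (expectation_finite_support supp); last exact: measurable_indic.
  congr EFin.
  transitivity (\sum_(0 <= m < k.+1) \sum_(0 <= j < k.+2) c j * ((m ^_ j)%:R * q m)).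
    apply: eq_big_nat => m /andP[_ mk]; rewrite -/(f m) cE; last exact: leq_trans mk _.
    by rewrite mulr_suml; apply: eq_bigr => j _; rewrite mulrA.
  rewrite exchange_big; apply: eq_big_nat => j /andP[_ jk].
  rewrite -mulr_sumr; congr (_ * _); rewrite /limit_moment.
  case: ifPn => [/momq //|kj]; rewrite big_nat big1// => m /andP[_ mk].
  by rewrite ffact_small ?mul0r// (leq_trans mk)// ltnNge.
under eq_fun => n do rewrite cdf_cycle_countE.
apply: cvg_EFin; first exact: nearW.
exact: cvg_mean_count cE.
Qed.

End LimitLaw.

Theorem theorem9 (R : realType) (k : nat) (gamma delta : R)
    (hk : (0 < k)%N) (hgamma : k.+1%:R^-1 <= gamma)
    (hgd : gamma < delta) (hdelta : delta <= k%:R^-1) :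
  (exists (d : measure_display) (T : measurableType d) (Q : probability T R)
     (Y : {RV Q >-> R}), quasi_poisson k (ln (delta / gamma)) Y) /\
  (forall (d : measure_display) (T : measurableType d) (Q : probability T R)
     (Y : {RV Q >-> R}), quasi_poisson k (ln (delta / gamma)) Y ->
     cvg_in_distribution (cycle_countRV gamma delta) Y).
Proof.
split; last by move=> d T Q Y; exact: cvg_cdf_quasi_poisson.
have [p [p0 mom]] := limit_pmf_exists hk hgd hgamma hdelta.
have p1 : \sum_(0 <= m < k.+1) p m = 1.
  by rewrite -[RHS](mom 0)//; apply: eq_bigr => m _; rewrite ffactn0 mulr1.
exists _, _, _, (nat_lawRV p0 p1).
exact: quasi_poisson_nat_lawRV.
Qed.
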